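(* Let $G$ be a finite, undirected, simple, triangle-free graph with at least one vertex and with maximum degree $\Delta$. Then, for any real $\lambda>0$, $$V_G(\lambda)\;\geq\;\frac{\lambda}{(\Delta+1)(1+\lambda)^2}\cdot\frac{W\!\left(\Delta\log(1+\lambda)\right)}{\Delta\log(1+\lambda)},$$ where $W$ is the principal real branch of the Lambert $W$-function, and where for $\Delta=0$ the quotient $W(x)/x$ at $x=0$ is read as its limiting value $1$.
   Context: All graphs are finite, undirected and simple, with at least one vertex. $\log$ is the natural logarithm. For real $z\geq 0$, $W(z)$ denotes the unique nonnegative real number $w$ satisfying $we^{w}=z$ (the principal branch of the Lambert $W$-function). For a graph $G$ on $n$ vertices, $\mathcal{I}(G)$ is the set of all independent sets of $G$ (including the empty set), and the independence polynomial (partition function of the hard-core model) is $P_G(\lambda)=\sum_{I\in\mathcal{I}(G)}\lambda^{|I|}$ for $\lambda>0$. The hard-core model on $G$ at fugacity $\lambda$ is the probability measure on $\mathcal{I}(G)$ given by $\Pr[I]=\lambda^{|I|}/P_G(\lambda)$. The free energy density is $F_G(\lambda)=\frac1n\log P_G(\lambda)$, the occupancy fraction is $E_G(\lambda)=\lambda\frac{\partial}{\partial\lambda}F_G(\lambda)$, and the variance fraction is $V_G(\lambda)=\lambda\frac{\partial}{\partial\lambda}E_G(\lambda)$. Equivalently, $nE_G(\lambda)=\mathbb{E}(|I|)$ and $nV_G(\lambda)=\operatorname{Var}(|I|)$, where $I$ is drawn from the hard-core model on $G$ at fugacity $\lambda$. *)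

(* Defs.v *)
From mathcomp Require Import all_boot all_order all_algebra.
From mathcomp Require Import all_classical all_reals all_analysis.
Import Order.TTheory GRing.Theory Num.Theory.
Import numFieldNormedType.Exports.

Set Implicit Arguments.
Unset Strict Implicit.
Unset Printing Implicit Defensive.

Local Open Scope classical_set_scope.
Local Open Scope ring_scope.

Section Graphs.
Variables (T : finType) (e : rel T).

Definition simple_graph : Prop := symmetric e /\ irreflexive e.

Definition triangle_free : Prop := forall x y z, ~ [/\ e x y, e y z & e x z].

Definition degree (v : T) : nat := #|[set u : T | e v u]%SET|.

Definition max_degree : nat := (\max_(v : T) degree v)%N.

Definition independent (I : {set T}) : bool :=
  [forall x in I, forall y in I, ~~ e x y].

End Graphs.

Section HardCore.
Variables (R : realType) (T : finType) (e : rel T).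

Definition indep_poly (lambda : R) : R :=
  \sum_(I : {set T} | independent e I) lambda ^+ #|I|.

Definition free_energy_density (lambda : R) : R :=
  #|T|%:R^-1 * ln (indep_poly lambda).

Definition occupancy_fraction (lambda : R) : R :=
  lambda * derive1 free_energy_density lambda.

Definition variance_fraction (lambda : R) : R :=
  lambda * derive1 occupancy_fraction lambda.

End HardCore.

Section LambertW.
Variable R : realType.

(* Only meaningful for 0 <= z, where [lambertWP] and [lambertW_unique] show
   that it is the unique nonnegative solution; the value is 0 for z < 0. *)
Definition lambertW (z : R) : R :=
  xget 0 [set w : R | 0 <= w /\ w * expR w = z].

Lemma mul_expR_inj (v w : R) :
  0 <= v -> 0 <= w -> v * expR v = w * expR w -> v = w.
Proof.
have mono (a b : R) : 0 <= a -> a < b -> a * expR a < b * expR b.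
  move=> a0 ab; apply: ltr_pM; rewrite ?expR_ge0 //.
  by rewrite ltr_expR.
move=> v0 w0 vw; case: (ltgtP v w) => // h.
  by move: (mono _ _ v0 h); rewrite vw ltxx.
by move: (mono _ _ w0 h); rewrite vw ltxx.
Qed.

Lemma lambertWP (z : R) :
  0 <= z -> 0 <= lambertW z /\ lambertW z * expR (lambertW z) = z.
Proof.
move=> z0.
apply: (@xgetPex _ 0 [set w : R | 0 <= w /\ w * expR w = z]).
have cf : {within `[0, z], continuous (fun w : R => w * expR w)}.
  apply: continuous_subspaceT => x.
  by apply: cvgM; [exact: cvg_id | exact: continuous_expR].
have le : z <= z * expR z.
  by rewrite ler_peMr // -expR0 ler_expR.
have [|c] := @IVT R (fun w => w * expR w) 0 z z z0 cf.
  by rewrite mul0r ge_min z0 le_max le orbT.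
by rewrite in_itv /= => /andP[c0 _] cz; exists c.
Qed.

Lemma lambertW_unique (z w : R) :
  0 <= w -> w * expR w = z -> lambertW z = w.
Proof.
move=> w0 wz.
have z0 : 0 <= z by rewrite -wz mulr_ge0 // expR_ge0.
have [W0 Wz] := lambertWP z0.
by apply: mul_expR_inj => //; rewrite Wz wz.
Qed.

(* The quotient W(x) / x, continuously extended by the value 1 at x = 0. *)
Definition lambertW_quot (x : R) : R :=
  if x == 0 then 1 else lambertW x / x.

End LambertW.

(* Main.v *)
(* Say that [v] is covered by an independent set [I] when [I] meets its
   neighbourhood, and let [X_v] be [1 + lambda] times the indicator of [v \in I]
   minus [lambda] times the indicator that [v] is uncovered. [X_v] is orthogonal
   to every function of [I] that ignores [v]. Hence [X = \sum_v X_v] has mean [0],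
   E (|I| X) = E |I|, and E (X_v X_w) vanishes unless [v = w] or [v] and [w] are
   adjacent, which gives E X^2 <= (Delta + 1) (1 + lambda) E |I|. Cauchy-Schwarz
   yields Var |I| >= E |I| / ((Delta + 1) (1 + lambda)).
   In a triangle-free graph the probability that [v] is uncovered is
   E (1 + lambda)^(- Z_v) for [Z_v] the number of uncovered neighbours of [v].
   Averaging over [v] and applying Jensen's inequality, the mean fraction [x] of
   uncovered vertices satisfies x >= exp (- Delta log (1 + lambda) x), a bound in
   terms of [W], and E |I| = lambda / (1 + lambda) * n x. *)
Require Import Defs.
From mathcomp Require Import all_boot all_order all_algebra.
From mathcomp Require Import all_classical all_reals all_analysis.
From mathcomp Require Import ring lra finset.
Import Order.TTheory GRing.Theory Num.Theory.
Import numFieldNormedType.Exports.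

Set Implicit Arguments.
Unset Strict Implicit.
Unset Printing Implicit Defensive.

Local Open Scope ring_scope.

(** * Independent sets and weighted sums over them *)

Section HardCoreSums.
Variables (R : realType) (T : finType) (e : rel T) (lambda : R).
Hypotheses (e_sym : symmetric e) (e_irr : irreflexive e).

(* The expectation of [f] under the hard-core model, multiplied by the
   partition function. *)
Definition hc_sum (f : {set T} -> R) : R :=
  \sum_(I : {set T} | independent e I) lambda ^+ #|I| * f I.

Definition occupied (v : T) (I : {set T}) : R := (v \in I)%:R.

(** Membership of [v] itself is left out, so that for irreflexive [e] the value does not change when
    [v] is inserted. *)
Definition free_at (v : T) (I : {set T}) : bool := [forall u in I, ~~ e v u].

Definition uncovered (v : T) (I : {set T}) : R := (free_at v I)%:R.

Lemma independentP (I : {set T}) :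
  reflect (forall x y, x \in I -> y \in I -> ~~ e x y) (independent e I).
Proof.
apply: (iffP 'forall_implyP) => [h x y xI yI|h x xI].
  by move: (h x xI) => /'forall_implyP/(_ y yI).
by apply/'forall_implyP => y yI; exact: h.
Qed.

Lemma free_atP v (I : {set T}) :
  reflect (forall u, u \in I -> ~~ e v u) (free_at v I).
Proof. exact: 'forall_implyP. Qed.

Lemma free_atU v (I J : {set T}) :
  free_at v (I :|: J) = free_at v I && free_at v J.
Proof.
apply/free_atP/andP => [h|[/free_atP hI /free_atP hJ] u].
  by split; apply/free_atP => u uI; apply: h; rewrite inE uI ?orbT.
by rewrite inE => /orP[/hI|/hJ].
Qed.

Lemma free_at1 v u : free_at v [set u] = ~~ e v u.
Proof.
by apply/free_atP/idP => [->|? w /set1P ->//]; rewrite ?inE.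
Qed.

Lemma independentS (I J : {set T}) :
  I \subset J -> independent e J -> independent e I.
Proof.
move=> /fintype.subsetP IJ /independentP h; apply/independentP => x y xI yI.
by apply: h; apply: IJ.
Qed.

Lemma independentU1 v (I : {set T}) :
  independent e (v |: I) = free_at v I && independent e I.
Proof.
apply/idP/andP => [h|[/free_atP vI /independentP h]].
  split; last exact: independentS (subsetUr _ _) h.
  move/independentP: h => h; apply/free_atP => u uI.
  by apply: h; rewrite !inE ?eqxx ?uI ?orbT.
apply/independentP => x y /setU1P[->|xI] /setU1P[->|yI].
- by rewrite e_irr.
- exact: vI.
- by rewrite e_sym; exact: vI.
- exact: h.
Qed.

(** Insertion suffices: for [v] in [I], the equation at [I :\ v] gives invariance under deletion. *)
Definition ignores (v : T) (f : {set T} -> R) :=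
  forall I, f (v |: I) = f I.

Lemma hc_sumD f g : hc_sum (fun I => f I + g I) = hc_sum f + hc_sum g.
Proof. by rewrite -big_split; apply: eq_bigr => I _; rewrite mulrDr. Qed.

Lemma hc_sumZ a f : hc_sum (fun I => a * f I) = a * hc_sum f.
Proof. by rewrite big_distrr; apply: eq_bigr => I _ /=; rewrite mulrCA. Qed.

Lemma hc_sum_sum (f : T -> {set T} -> R) (A : pred T) :
  hc_sum (fun I => \sum_(v | A v) f v I) = \sum_(v | A v) hc_sum (f v).
Proof.
by rewrite exchange_big; apply: eq_bigr => I _; rewrite big_distrr.
Qed.

Lemma eq_hc_sum f g :
  (forall I, independent e I -> f I = g I) -> hc_sum f = hc_sum g.
Proof. by move=> h; apply: eq_bigr => I /h ->. Qed.

Lemma ler_hc_sum f g : 0 <= lambda ->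
  (forall I, independent e I -> f I <= g I) -> hc_sum f <= hc_sum g.
Proof.
move=> l0 h; apply: ler_sum => I /h; apply: ler_wpM2l.
by rewrite exprn_ge0.
Qed.

(* Pairs each independent set containing [v] with the one obtained by
   deleting [v]. *)
Lemma hc_sum_occupied v f : ignores v f ->
  hc_sum (fun I => f I * occupied v I) =
  lambda * hc_sum (fun I => f I * ((v \notin I) && free_at v I)%:R).
Proof.
move=> fv; rewrite /hc_sum /occupied.
rewrite (bigID (fun I : {set T} => v \in I)) /= addrC big1 ?add0r; last first.
  by move=> I /andP[_ /negPf ->]; rewrite !mulr0.
rewrite [in RHS](bigID (fun I : {set T} => (v \notin I) && free_at v I)) /=.
rewrite [X in _ = _ * (_ + X)]big1 ?addr0; last first.
  by move=> I /andP[_ /negPf ->]; rewrite !mulr0.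
rewrite (reindex_onto (fun I => v |: I) (fun I => I :\ v)) /=; last first.
  by move=> I /andP[_ vI]; rewrite setD1K.
rewrite big_distrr /=; apply: eq_big => [I|I /andP[/andP[iI _] vI]].
  rewrite setU11 independentU1 andbT; have [vI|vI] /= := boolP (v \in I).
    rewrite andbF; apply/negbTE; rewrite negb_and; apply/orP; right.
    by apply: contraTneq vI => <-; rewrite !inE eqxx.
  by rewrite setU1K // eqxx andbT andbC.
have {}vI : v \notin I by rewrite -(eqP vI) !inE eqxx.
move: iI; rewrite independentU1 => /andP[-> _].
by rewrite cardsU1 vI exprS fv setU11 !mulr1 mulrA.
Qed.

(** * Orthogonality of the variables [centred v] and the variance bound *)

Definition centred (v : T) (I : {set T}) : R :=
  (1 + lambda) * occupied v I - lambda * uncovered v I.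

Lemma independent_uncovered v (I : {set T}) :
  independent e I -> v \in I -> free_at v I.
Proof.
by move=> /independentP h vI; apply/free_atP => u uI; exact: h.
Qed.

(** When [v] is uncovered, it is either occupied or free to be added. The second case has
    [lambda^-1] times the weight of the first, so [lambda] times the uncovered sum is [1 + lambda]
    times the occupied one. *)
Lemma hc_sum_centred v f : ignores v f ->
  hc_sum (fun I => f I * centred v I) = 0.
Proof.
move=> fv; have := hc_sum_occupied fv.
rewrite [X in _ = _ * X](@eq_hc_sum _ (fun I => f I * uncovered v I + -1 * (f I * occupied v I))).
  rewrite hc_sumD hc_sumZ => h.
  rewrite (@eq_hc_sum _ (fun I => (1 + lambda) * (f I * occupied v I) +
     (- lambda) * (f I * uncovered v I))); last first.
    by move=> I _; rewrite /centred; ring.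
  by rewrite hc_sumD !hc_sumZ {1}mulrDl mul1r {1}h; ring.
move=> I iI; rewrite /uncovered /occupied; have [vI|vI] /= := boolP (v \in I).
  by rewrite (independent_uncovered iI vI) /=; ring.
by ring.
Qed.

Definition card_sum : R := hc_sum (fun I => #|I|%:R).

Lemma cardE_occupied (I : {set T}) : #|I|%:R = \sum_(v : T) occupied v I.
Proof.
by rewrite -sum1_card natr_sum big_mkcond; apply: eq_bigr => v _; rewrite /occupied; case: ifP.
Qed.

Lemma card_sumE : card_sum = \sum_(v : T) hc_sum (occupied v).
Proof.
rewrite -hc_sum_sum; apply: eq_hc_sum => I _; exact: cardE_occupied.
Qed.

Lemma occupiedM_centred v I : independent e I ->
  occupied v I * centred v I = occupied v I.
Proof.
move=> iI; rewrite /centred /occupied /uncovered.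
have [vI|_] := boolP (v \in I); last by rewrite mul0r.
by rewrite (independent_uncovered iI vI) /=; ring.
Qed.

Lemma ignores_occupied v w : v != w -> ignores v (occupied w).
Proof. by move=> vw I; rewrite /occupied !inE eq_sym (negPf vw). Qed.

Lemma ignores_uncovered v w : ~~ e w v -> ignores v (uncovered w).
Proof. by move=> vw I; rewrite /uncovered free_atU free_at1 vw. Qed.

Lemma ignores_centred v w : v != w -> ~~ e w v -> ignores v (centred w).
Proof.
by move=> h1 h2 I; rewrite /centred ignores_occupied // ignores_uncovered.
Qed.

(** In [#|I| = (v \in I) + #|I :\ v|] the second summand ignores [v], hence is orthogonal to
    [centred v]. *)
Lemma hc_sum_cardM_centred v :
  hc_sum (fun I => #|I|%:R * centred v I) = hc_sum (occupied v).
Proof.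
rewrite (@eq_hc_sum _ (fun I => occupied v I + #|I :\ v|%:R * centred v I)).
  rewrite hc_sumD hc_sum_centred ?addr0 // => I.
  by rewrite setDUl setDv set0U.
move=> I iI; rewrite (cardsD1 v) natrD mulrDl; congr (_ + _).
exact: occupiedM_centred.
Qed.

(** Expand one factor only: [uncovered v] ignores [v] and drops out, while [centred v] is 1 where
    [v] is occupied. *)
Lemma hc_sum_centred_sqr v :
  hc_sum (fun I => centred v I * centred v I) =
  (1 + lambda) * hc_sum (occupied v).
Proof.
rewrite (@eq_hc_sum _ (fun I => (1 + lambda) * occupied v I +
   (- lambda) * (uncovered v I * centred v I))).
  rewrite hc_sumD !hc_sumZ hc_sum_centred ?mulr0 ?addr0 //.
  by apply: ignores_uncovered; rewrite e_irr.
by move=> I iI; rewrite -[X in _ = _ * X + _](occupiedM_centred v iI) {1}/centred; ring.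
Qed.

Lemma hc_sum_centred_nonadj v w : v != w -> ~~ e v w ->
  hc_sum (fun I => centred v I * centred w I) = 0.
Proof.
move=> vw nvw; apply: hc_sum_centred; apply: ignores_centred => //.
by rewrite eq_sym.
Qed.

Lemma hc_sum_ge0 f : 0 <= lambda ->
  (forall I, independent e I -> 0 <= f I) -> 0 <= hc_sum f.
Proof.
move=> l0 h; apply: sumr_ge0 => I iI.
by rewrite mulr_ge0 ?exprn_ge0 ?h.
Qed.

(** If one endpoint is occupied, the other is unoccupied and covered, and the product is 0.
    Otherwise it is at most [lambda ^+ 2] times the indicator that [v] is unoccupied and uncovered,
    an event whose weight times [lambda] is the occupied sum. *)
Lemma hc_sum_centred_adj v w : 0 <= lambda -> e v w ->
  hc_sum (fun I => centred v I * centred w I) <= lambda * hc_sum (occupied v).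
Proof.
move=> l0 vw.
have hv : ignores v (fun=> 1 : R) by [].
have := hc_sum_occupied hv.
rewrite (@eq_hc_sum _ (occupied v)) => [->|I _]; last by rewrite mul1r.
rewrite mulrA -hc_sumZ; apply: ler_hc_sum => // I iI.
rewrite mul1r /centred /occupied /uncovered.
have cov x y : e x y -> x \in I -> free_at y I = false.
  move=> xy xI; apply/negbTE/free_atP => /(_ x xI).
  by rewrite e_sym xy.
have indep x y : e x y -> x \in I -> y \notin I.
  by move: iI => /independentP h xy xI; apply/negP => /(h _ _ xI); rewrite xy.
have [vI|vI] /= := boolP (v \in I).
  by rewrite (negPf (indep _ _ vw vI)) (cov _ _ vw vI) !mulr0 subr0 mulr0.
have [wI|wI] /= := boolP (w \in I).
  by rewrite e_sym in vw; rewrite (cov _ _ vw wI) !mulr0 subr0 mul0r.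
rewrite !mulr0 !sub0r mulrNN mulrACA.
case: (free_at v I) => /=; last by rewrite mul0r !mulr0.
by apply: ler_wpM2l; [exact: mulr_ge0|rewrite mul1r; case: (free_at w I)].
Qed.

Lemma hc_sum_occupied_ge0 v : 0 <= lambda -> 0 <= hc_sum (occupied v).
Proof. by move=> l0; apply: hc_sum_ge0 => // I _; rewrite ler0n. Qed.

(** For each [v], the diagonal term and the at most [max_degree e] adjacent terms each contribute at
    most [(1 + lambda) * hc_sum (occupied v)]. *)
Lemma hc_sum_total_centred_sqr : 0 <= lambda ->
  hc_sum (fun I => (\sum_(v : T) centred v I) ^+ 2) <=
  ((max_degree e)%:R + 1) * (1 + lambda) * card_sum.
Proof.
move=> l0; rewrite card_sumE big_distrr /=.
rewrite (@eq_hc_sum _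
  (fun I => \sum_(v : T) \sum_(w : T) centred v I * centred w I)); last first.
  by move=> I _; rewrite expr2 big_distrlr.
rewrite hc_sum_sum; apply: ler_sum => v _; rewrite hc_sum_sum.
have O0 := hc_sum_occupied_ge0 v l0.
rewrite (bigD1 v) //= hc_sum_centred_sqr (bigID (fun w => e v w)) /=.
rewrite [X in _ + (_ + X)]big1 ?addr0; last first.
  by move=> w /andP[wv nvw]; apply: hc_sum_centred_nonadj => //; rewrite eq_sym.
rewrite [_ + 1]addrC -mulrA [leRHS]mulrDl mul1r lerD2l.
apply: (@le_trans _ _ (\sum_(w | (w != v) && e v w)
    (1 + lambda) * hc_sum (occupied v))).
  apply: ler_sum => w /andP[_ vw].
  apply: (le_trans (hc_sum_centred_adj l0 vw)).
  by rewrite ler_wpM2r // lerDr.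
rewrite sumr_const -[leLHS]mulr_natl; apply: ler_wpM2r.
  by rewrite mulr_ge0 // addr_ge0.
rewrite ler_nat; apply: (leq_trans _ (leq_bigmax v)).
rewrite /degree cardsE; apply: subset_leq_card; apply/fintype.subsetP => w.
by rewrite !unfold_in => /andP[].
Qed.

Lemma hc_sum_variance m : 0 < lambda ->
  m * hc_sum (fun=> 1) = card_sum ->
  card_sum / (((max_degree e)%:R + 1) * (1 + lambda)) <=
  hc_sum (fun I => #|I|%:R ^+ 2) - m * card_sum.
Proof.
move=> l0 hm.
set D := _ * (1 + lambda).
have D0 : 0 < D by apply: mulr_gt0; [rewrite ltr_wpDl|rewrite addr_gt0].
have Q := hc_sum_total_centred_sqr (ltW l0).
set X := fun I => \sum_(v : T) centred v I.
have SX : hc_sum X = 0.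
  rewrite hc_sum_sum big1 // => v _; rewrite -[RHS](@hc_sum_centred v (fun=> 1)) //.
  by apply: eq_hc_sum => I _; rewrite mul1r.
have CX : hc_sum (fun I => #|I|%:R * X I) = card_sum.
  rewrite card_sumE -(eq_bigr _ (fun v _ => hc_sum_cardM_centred v)).
  by rewrite -hc_sum_sum; apply: eq_hc_sum => I _; rewrite big_distrr.
(* Cauchy-Schwarz by one explicit square. The coefficient [D^-1] is the best one when the second
   moment of [X] equals its upper bound [D * card_sum]; [m] is the mean size. *)
have : 0 <= hc_sum (fun I => (#|I|%:R - m - D^-1 * X I) ^+ 2).
  by apply: hc_sum_ge0 => [|I _]; [exact: ltW|exact: sqr_ge0].
rewrite (@eq_hc_sum _ (fun I => #|I|%:R ^+ 2 + (- m *+ 2 * #|I|%:R +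
  (m ^+ 2 * 1 + (- D^-1 *+ 2 * (#|I|%:R * X I) + (m * D^-1 *+ 2 * X I +
   D^-1 ^+ 2 * (X I) ^+ 2)))))); last by move=> I _; ring.
rewrite !hc_sumD !hc_sumZ SX CX -/card_sum.
move: Q; rewrite -/D -/X => Q.
have {}Q : D^-1 ^+ 2 * hc_sum (fun I => X I ^+ 2) <= D^-1 * card_sum.
  have := ler_wpM2l (sqr_ge0 D^-1) Q; congr (_ <= _).
  by rewrite mulrA expr2 -[_ * D]mulrA mulVf ?mulr1 ?gt_eqF.
have -> : m ^+ 2 * hc_sum (fun=> 1) = m * card_sum by rewrite expr2 -mulrA hm.
by move: Q; rewrite mulrC; lra.
Qed.

(** * Lower bound on the occupancy in triangle-free graphs *)

Definition free_nbrs (v : T) (I : {set T}) : {set T} :=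
  [set w | e v w & free_at w I].

Lemma sum_subset_exp (U : {set T}) (x : R) :
  \sum_(K : {set T} | K \subset U) x ^+ #|K| = (1 + x) ^+ #|U|.
Proof.
(* Expand the product over all vertices of [x + 1] on [U] and [0 + 1] elsewhere; the zeros kill
   every [K] not inside [U]. *)
have := @bigA_distr R 0 1 *%R +%R T (fun i => if i \in U then x else 0) (fun=> 1).
rewrite (bigID (fun i => i \in U)) /= [X in _ * X]big1 => [|i /negPf ->]; last first.
  by rewrite add0r.
rewrite mulr1 (eq_bigr (fun=> 1 + x)) => [|i ->]; last by rewrite addrC.
rewrite prodr_const => ->; rewrite big_mkcond; apply: eq_bigr => K _.
case: ifPn => [/fintype.subsetP KU|/subsetPn[k kK kU]].
  rewrite -prodr_const big_mkcond; apply: eq_bigr => i _.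
  by case: ifP => // /KU ->.
by rewrite (bigD1 k) //= kK (negPf kU) mul0r.
Qed.

(* Resampling the neighbourhood of [v], which is an independent set since [e]
   is triangle-free: given the rest [J] of the independent set, with [v]
   uncovered by [J], the trace on the neighbourhood is an arbitrary subset of
   [free_nbrs v J], so that it is empty with probability
   [(1 + lambda) ^- #|free_nbrs v J|]. *)
Lemma hc_sum_uncovered_exp v : 0 <= lambda -> triangle_free e ->
  hc_sum (uncovered v) = hc_sum (fun I => (1 + lambda) ^- #|free_nbrs v I|).
Proof.
move=> l0 tf; pose N := [set w | e v w].
have tfN x y : x \in N -> y \in N -> ~~ e x y.
  by rewrite !inE => vx vy; apply/negP => xy; apply: (tf v x y).
transitivity (\sum_(J : {set T} | independent e J && free_at v J) lambda ^+ #|J|).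
  rewrite [RHS]big_mkcondr; apply: eq_bigr => I _.
  by rewrite /uncovered; case: ifP; rewrite (mulr1, mulr0).
rewrite [RHS](partition_big (fun I => I :\: N)
  (fun J => independent e J && free_at v J)) /=; last first.
  move=> I iI; rewrite (independentS (subsetDl _ _) iI) /=.
  by apply/free_atP => u; rewrite !inE => /andP[].
apply: eq_bigr => J /andP[/independentP iJ /free_atP vJ].
have JN : J :&: N = set0.
  by apply/setP => u; rewrite !inE; case: (boolP (u \in J)) => //= /vJ /negPf.
rewrite (reindex_onto (fun K => J :|: K) (fun I => I :&: N)) /=; last first.
  by move=> I /andP[_ /eqP <-]; rewrite setUC setID.
have free_sub (K : {set T}) : K \subset N -> forall w, w \in N -> free_at w (J :|: K) = free_at w J.
  move=> /fintype.subsetP KN w wN; rewrite free_atU.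
  suff -> : free_at w K by rewrite andbT.
  by apply/free_atP => u /KN; exact: tfN.
have UN : free_nbrs v J \subset N.
  by apply/fintype.subsetP => w; rewrite !inE => /andP[].
rewrite (eq_big (fun K : {set T} => K \subset free_nbrs v J)
  (fun K => (lambda ^+ #|J| * (1 + lambda) ^- #|free_nbrs v J|) * lambda ^+ #|K|)).
- rewrite -big_distrr /= sum_subset_exp mulfVK //.
  by rewrite expf_neq0 // gt_eqF // ltr_pwDl.
- move=> K; apply/idP/idP.
    move=> /andP[/andP[/independentP iJK _] /eqP KN].
    apply/fintype.subsetP => k kK; rewrite inE; apply/andP; split.
      by move: kK; rewrite -KN !inE => /andP[].
    by apply/free_atP => u uJ; apply: iJK; rewrite inE ?kK ?uJ ?orbT.
  move=> KU; have KN := fintype.subset_trans KU UN; rewrite -andbA; apply/and3P; split.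
  + have KF k : k \in K -> free_at k J.
      by move/fintype.subsetP: KU => /[apply]; rewrite inE => /andP[].
    have KF' k u : k \in K -> u \in J -> ~~ e k u by move=> /KF/free_atP; exact.
    move/fintype.subsetP: KN => KN.
    apply/independentP => x y /setUP[xJ|xK] /setUP[yJ|yK].
    * exact: iJ.
    * by rewrite e_sym KF'.
    * exact: KF'.
    * by apply: tfN; exact: KN.
  + move: KN; rewrite setDUl -setD_eq0 => /eqP ->; rewrite setU0.
    by apply/eqP/setDidPl; rewrite -setI_eq0 JN.
  + by rewrite setIUl JN set0U; apply/eqP/setIidPl.
move=> K /andP[_ /eqP KN].
have {}KN : K \subset N by rewrite -KN subsetIr.
have -> : #|J :|: K| = (#|J| + #|K|)%N.
  rewrite cardsU; suff -> : J :&: K = set0 by rewrite cards0 subn0.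
  by apply/eqP; rewrite -subset0 -JN setIS.
have -> : free_nbrs v (J :|: K) = free_nbrs v J.
  apply/setP => w; rewrite !inE; case: (boolP (e v w)) => //= vw.
  by rewrite free_sub // inE.
by rewrite exprD mulrAC.
Qed.

(** Orthogonality of [centred v] to the constant 1. *)
Lemma hc_sum_uncovered v :
  lambda * hc_sum (uncovered v) = (1 + lambda) * hc_sum (occupied v).
Proof.
have := @hc_sum_centred v (fun=> 1) (fun=> erefl).
rewrite (@eq_hc_sum _ (fun I => (1 + lambda) * occupied v I +
  - lambda * uncovered v I)); last by move=> I _; rewrite mul1r /centred mulNr.
by rewrite hc_sumD !hc_sumZ mulNr => /eqP; rewrite subr_eq0 => /eqP.
Qed.

(** Double counting: an uncovered [w] is counted once for each of its neighbours. *)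
Lemma sum_free_nbrs : 0 <= lambda ->
  \sum_(v : T) hc_sum (fun I => #|free_nbrs v I|%:R) <=
  (max_degree e)%:R * \sum_(v : T) hc_sum (uncovered v).
Proof.
move=> l0.
rewrite (eq_bigr (fun v => \sum_(w | e v w) hc_sum (uncovered w))); last first.
  move=> v _; rewrite -hc_sum_sum; apply: eq_hc_sum => I _.
  rewrite -sum1_card natr_sum [RHS]big_mkcond [LHS]big_mkcond /=.
  apply: eq_bigr => w _; rewrite /uncovered !inE.
  by case: (e v w) => //=; case: (free_at w I).
rewrite (exchange_big_dep predT) //= big_distrr /=; apply: ler_sum => w _.
rewrite sumr_const -[leLHS]mulr_natl ler_wpM2r //.
  by apply: hc_sum_ge0 => // I _; rewrite ler0n.
rewrite ler_nat; apply: (leq_trans _ (leq_bigmax w)).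
rewrite /degree cardsE; apply: subset_leq_card; apply/fintype.subsetP => u.
by rewrite !unfold_in e_sym.
Qed.

Lemma hc_sum1_gt0 : 0 < lambda -> 0 < hc_sum (fun=> 1).
Proof.
move=> l0; rewrite /hc_sum (bigD1 set0) /=; last first.
  by apply/independentP => x y; rewrite inE.
rewrite cards0 expr0 mulr1 ltr_pwDl // sumr_ge0 // => I _.
by rewrite mulr1 exprn_ge0 // ltW.
Qed.

Lemma jensen_uncovered (x : R) : (0 < #|T|)%N -> 0 < lambda -> triangle_free e ->
  \sum_(v : T) hc_sum (uncovered v) = x * (#|T|%:R * hc_sum (fun=> 1)) ->
  expR (- ((max_degree e)%:R * ln (1 + lambda) * x)) <= x.
Proof.
move=> T0 l0 tf xE.
have P0 := hc_sum1_gt0 l0.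
have nP0 : 0 < #|T|%:R * hc_sum (fun=> 1) by rewrite mulr_gt0 // ltr0n.
set L := ln (1 + lambda); set D := (max_degree e)%:R.
have L0 : 0 <= L by rewrite ln_ge0 // lerDl ltW.
have eL : expR (- L) = (1 + lambda)^-1 by rewrite expRN lnK // posrE addr_gt0.
set m := D * L * x.
rewrite -(ler_pM2r nP0) -xE.
have tangent z : expR (- m) * (1 + m + - L * z%:R) <= (1 + lambda) ^- z.
  rewrite -exprVn -eL -expRM_natr.
  have -> : - L * z%:R = - m + (m - L * z%:R) by ring.
  rewrite expRD ler_wpM2l ?expR_ge0 //.
  by apply: le_trans (expR_ge1Dx _); rewrite le_eqVlt; apply/orP; left; apply/eqP; ring.
have : expR (- m) * ((1 + m) * (#|T|%:R * hc_sum (fun=> 1)) +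
   - L * \sum_(v : T) hc_sum (fun I => #|free_nbrs v I|%:R)) <=
   \sum_(v : T) hc_sum (uncovered v).
  have -> : (1 + m) * (#|T|%:R * hc_sum (fun=> 1)) =
            \sum_(v : T) (1 + m) * hc_sum (fun=> 1).
    by rewrite sumr_const -[RHS]mulr_natl mulrCA.
  rewrite [X in _ + X]big_distrr -big_split big_distrr /=; apply: ler_sum => v _.
  rewrite hc_sum_uncovered_exp ?(ltW l0) // -!hc_sumZ -hc_sumD -hc_sumZ.
  by apply: ler_hc_sum => [|I _]; [exact: ltW|rewrite mulr1].
apply: le_trans; apply: ler_wpM2l; first exact: expR_ge0.
have := ler_wpM2l L0 (sum_free_nbrs (ltW l0)).
rewrite -/D xE => h.
set S := \sum_(v : T) _ in h *.
have -> : (1 + m) * (#|T|%:R * hc_sum (fun=> 1)) = #|T|%:R * hc_sum (fun=> 1) +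
  L * (D * (x * (#|T|%:R * hc_sum (fun=> 1)))) by rewrite /m; ring.
by rewrite mulNr -addrA lerDl subr_ge0.
Qed.

Lemma hc_sum_card_lower_bound :
  (0 < #|T|)%N -> 0 < lambda -> triangle_free e ->
  lambda / (1 + lambda) * lambertW_quot ((max_degree e)%:R * ln (1 + lambda)) <=
  card_sum / (#|T|%:R * hc_sum (fun=> 1)).
Proof.
move=> T0 l0 tf.
have P0 := hc_sum1_gt0 l0.
have nP0 : 0 < #|T|%:R * hc_sum (fun=> 1) by rewrite mulr_gt0 // ltr0n.
have l1 : 1 + lambda != 0 by rewrite gt_eqF // addr_gt0.
set x := (\sum_(v : T) hc_sum (uncovered v)) / (#|T|%:R * hc_sum (fun=> 1)).
have xE : \sum_(v : T) hc_sum (uncovered v) = x * (#|T|%:R * hc_sum (fun=> 1)).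
  by rewrite /x mulfVK // gt_eqF.
have hx := jensen_uncovered T0 l0 tf xE.
have -> : card_sum / (#|T|%:R * hc_sum (fun=> 1)) = lambda / (1 + lambda) * x.
  rewrite /x mulrA; congr (_ / _).
  rewrite mulrAC big_distrr /= (eq_bigr _ (fun v _ => hc_sum_uncovered v)).
  by rewrite -big_distrr /= -card_sumE mulrC mulKf.
apply: ler_wpM2l; first by rewrite divr_ge0 // ltW // addr_gt0.
set z := (max_degree e)%:R * _ in hx *.
have z0 : 0 <= z by rewrite mulr_ge0 // ln_ge0 // lerDl ltW.
(* For [z = 0], which covers degree 0, the bound [hx] reads [1 <= x]. *)
rewrite /lambertW_quot; case: eqP => [z00|/eqP zn0].
  by move: hx; rewrite z00 mul0r oppr0 expR0.
have {z0 zn0} z0 : 0 < z by rewrite lt_def zn0.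
have [W0 WE] := lambertWP (ltW z0).
rewrite ler_pdivrMr // leNgt; apply/negP => xW.
have x0 : 0 < x by apply: lt_le_trans hx; exact: expR_gt0.
(* If [x * z] were below [W(z)], monotonicity of [w * expR w] would give this, whereas [hx] yields
   the reverse inequality. *)
have : x * z * expR (x * z) < z.
  have xz0 : 0 <= x * z by rewrite mulr_ge0 ?ltW.
  by rewrite -[ltRHS]WE; apply: ltr_pM; rewrite ?expR_ge0 ?ltr_expR.
apply/negP; rewrite -leNgt mulrAC -[leLHS]mul1r ler_wpM2r ?(ltW z0) //.
by rewrite -ler_pdivrMr ?expR_gt0 // mul1r -expRN [x * z]mulrC.
Qed.
End HardCoreSums.

(** * Occupancy and variance as moments, by differentiating the partition function *)

Section Derivatives.
Variables (R : realType) (T : finType) (e : rel T).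

Definition indep_polynomial : {poly R} :=
  \sum_(I : {set T} | independent e I) 'X^#|I|.

Let q := indep_polynomial.

Lemma indep_polyE x : indep_poly e x = q.[x].
Proof. by rewrite horner_sum; apply: eq_bigr => I _; rewrite hornerXn. Qed.

(** The operator [x d/dx] multiplies a monomial of degree k by k. *)
Lemma euler_indep_polynomial (x : R) :
  x * q^`().[x] = \sum_(I : {set T} | independent e I) x ^+ #|I| * #|I|%:R.
Proof.
rewrite raddf_sum horner_sum big_distrr; apply: eq_bigr => I _ /=.
rewrite derivXn hornerMn hornerXn -mulr_natr mulrA.
(* The empty set is separate: the truncated exponent [0.-1] is 0, but the factor [#|I|] vanishes. *)
by case: #|I| => [|n]; rewrite ?mulr0 // exprS.
Qed.

Lemma euler2_indep_polynomial (x : R) :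
  x * ('X * q^`())^`().[x] =
  \sum_(I : {set T} | independent e I) x ^+ #|I| * #|I|%:R ^+ 2.
Proof.
have -> : 'X * q^`() = \sum_(I : {set T} | independent e I) #|I|%:R *: 'X^#|I|.
  rewrite raddf_sum big_distrr; apply: eq_bigr => I _ /=.
  rewrite derivXn mulrnAr scaler_nat.
  by case: #|I| => [|n]; rewrite ?mulr0n // exprS.
rewrite raddf_sum horner_sum big_distrr; apply: eq_bigr => I _ /=.
rewrite derivZ derivXn hornerZ hornerMn hornerXn -mulr_natr.
by case: #|I| => [|n]; rewrite ?expr2 ?mulr0 ?mul0r ?mulr0 // exprS; ring.
Qed.

Lemma horner_indep_polynomial_gt0 (x : R) : 0 < x -> 0 < q.[x].
Proof.
move=> x0; rewrite horner_sum (bigD1 set0) /=; last first.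
  by apply/forallP => y; rewrite inE.
rewrite hornerXn cards0 expr0 ltr_pwDl // sumr_ge0 // => I _.
by rewrite hornerXn exprn_ge0 // ltW.
Qed.

Lemma occupancy_fractionE (x : R) : 0 < x ->
  occupancy_fraction e x = #|T|%:R^-1 * (('X * q^`()).[x] / q.[x]).
Proof.
move=> x0; have q0 := horner_indep_polynomial_gt0 x0.
rewrite /occupancy_fraction derive1E.
have dln : is_derive x (1:R) (@ln R \o horner q) (q.[x]^-1 * q^`().[x]).
  by apply: is_derive1_comp; exact: is_derive1_ln.
have dF : is_derive x (1:R) (free_energy_density e)
    (#|T|%:R^-1 *: (q.[x]^-1 * q^`().[x])).
  have -> : free_energy_density e = #|T|%:R^-1 \*: (@ln R \o horner q).
    by apply/funext => y; rewrite /free_energy_density indep_polyE.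
  exact: is_deriveZ.
by rewrite derive_val hornerM hornerX /GRing.scale /=; ring.
Qed.

Lemma variance_fractionE (x : R) : 0 < x ->
  let S k := hc_sum e x (fun I => #|I|%:R ^+ k) in
  variance_fraction e x = #|T|%:R^-1 * (S 2%N / S 0%N - (S 1%N / S 0%N) ^+ 2).
Proof.
move=> x0 S; have q0 := horner_indep_polynomial_gt0 x0.
(* The convention [0 ^+ 0 = 1] makes the empty set count here. *)
have S0E : S 0%N = q.[x].
  by rewrite horner_sum; apply: eq_bigr => I _; rewrite hornerXn expr0 mulr1.
have S1E : S 1%N = x * q^`().[x] by rewrite euler_indep_polynomial.
have S2E : S 2%N = x * ('X * q^`())^`().[x] by rewrite euler2_indep_polynomial.
rewrite S0E S1E S2E /variance_fraction derive1E.
set p := 'X * q^`().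
have dV : is_derive x (1:R) (fun y => (q.[y])^-1) (- q.[x] ^- 2 *: q^`().[x]).
  by apply: is_deriveV; rewrite gt_eqF.
have dM := is_deriveM (is_derive_poly p x) dV.
have dE : is_derive x (1:R) (#|T|%:R^-1 \*: (horner p * (fun y => (q.[y])^-1)))
   (#|T|%:R^-1 *: (p.[x] *: (- q.[x] ^- 2 *: q^`().[x]) + (q.[x])^-1 *: p^`().[x])).
  exact: is_deriveZ.
(* The closed form of the occupancy fraction is available only at positive points, which suffices
   near [x]. *)
rewrite (@near_eq_derive _ _ _ _ (#|T|%:R^-1 \*: (horner p * (fun y => (q.[y])^-1)))).
  rewrite derive_val {1}/p hornerM hornerX /GRing.scale /=.
  by move: #|T|%:R^-1 => c; field; rewrite gt_eqF.
near=> y; rewrite occupancy_fractionE //.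
by near: y; exact: lt_nbhsr.
Unshelve. all: by end_near.
Qed.
End Derivatives.

(** * Combination of the variance and occupancy bounds *)

Theorem theorem1p7 (R : realType) (T : finType) (e : rel T) (Delta : nat)
  (nonempty : (0 < #|T|)%N) (simple : simple_graph e)
  (trianglefree : triangle_free e) (maxdeg : max_degree e = Delta)
  (lambda : R) (lambda_gt0 : 0 < lambda) :
  variance_fraction e lambda >=
    lambda / ((Delta%:R + 1) * (1 + lambda) ^+ 2)
      * lambertW_quot (Delta%:R * ln (1 + lambda)).
Proof.
case: simple => e_sym e_irr; subst Delta.
have P0 := hc_sum1_gt0 e lambda_gt0.
have n0 : 0 < #|T|%:R :> R by rewrite ltr0n.
set D := (max_degree e)%:R + 1.
have D0 : 0 < D by rewrite ltr_wpDl.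
have l1 : 0 < 1 + lambda by rewrite addr_gt0.
have hE := hc_sum_card_lower_bound e_sym e_irr nonempty lambda_gt0 trianglefree.
rewrite variance_fractionE //=.
have -> : hc_sum e lambda (fun I => #|I|%:R ^+ 0) = hc_sum e lambda (fun=> 1) by [].
have -> : hc_sum e lambda (fun I => #|I|%:R ^+ 1) = card_sum e lambda by [].
set P := hc_sum e lambda (fun=> 1) in P0 hE *.
set A := card_sum e lambda in hE *.
(* The variance bound with mean size [m := A / P], still multiplied by the partition function
   [P]. *)
have hV : A / (D * (1 + lambda)) <=
    hc_sum e lambda (fun I => #|I|%:R ^+ 2) - A / P * A.
  by apply: hc_sum_variance => //; rewrite mulfVK // gt_eqF.
set B := hc_sum e lambda _ in hV *.
set Wq := lambertW_quot _ in hE *.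
have -> : lambda / (D * (1 + lambda) ^+ 2) * Wq =
    (lambda / (1 + lambda) * Wq) / (D * (1 + lambda)).
  by field; rewrite !gt_eqF.
have -> : #|T|%:R^-1 * (B / P - (A / P) ^+ 2) =
    (B - A / P * A) / (#|T|%:R * P).
  by field; rewrite !gt_eqF.
apply: (@le_trans _ _ (A / (#|T|%:R * P) / (D * (1 + lambda)))).
  by rewrite ler_wpM2r // invr_ge0 mulr_ge0 // ltW.
by rewrite mulrAC ler_wpM2r // invr_ge0 mulr_ge0 // ltW.
Qed.
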